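(* Let $X$ be a simple-edged reduced graph of graphs, all of whose vertices (of the underlying graph $\Gamma_U(X)$) have valence three, that represents a homomorphism $\Delta(H_1,H_2;M_j)\to\mathbb{F}$ from (the fundamental group of) a graph of free groups with two vertex groups $H_1,H_2$ and edge groups $M_j$ to a free group $\mathbb{F}$. Let $v_i$ be the vertices of $\Gamma_U(X)$, and for each $i$ let $\Delta_i$ be the intersection, in the vertex space of $v_i$, of the images of the three edge spaces incident to $v_i$. Let $\Delta=\bigsqcup_i\Delta_i$, let $\Sigma_1=\Delta\cap\Gamma_{H_1}$ and $\Sigma_2=\Delta\cap\Gamma_{H_2}$ be the sets of vertices of $\Delta$ lying in $\Gamma_{H_1}$ and $\Gamma_{H_2}$ respectively, and let $\mu$ be the number of edges in $\Delta$. Then \[ \chi(H_1)\chi(H_2)+\sum_j\chi(M_j)=\frac14|\Sigma_1|\cdot|\Sigma_2|-\frac12\mu . \]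
   Context: **Graphs of graphs.** A graph of graphs $X$ is a finite graph of spaces all of whose vertex spaces are (finite) combinatorial graphs and all of whose edge maps are embeddings. That is, there is a finite underlying graph $\Gamma_U(X)$, a graph $V$ for each vertex $v$, a graph $E$ for each edge $e$, and for each edge $e$ two embeddings of graphs of $E$ into the vertex spaces at the two endpoints of $e$. The total space, also denoted $X$, is obtained by gluing the ends of each $E\times I$ ($I=[0,1]$) to vertex spaces by these embeddings. Edges incident to a vertex are counted with multiplicity, a loop counting twice; the valence of a vertex is this count. **Reduced.** $X$ is reduced if none of the following operations changes it. (M1) Replace each vertex and edge by one copy for each connected component of its space (so in a reduced $X$ all vertex and edge spaces are connected). (M2) If a vertex space has exactly two incident edges and both inclusions are isomorphisms, remove the vertex and merge the two edges into one; if a vertex space has one incident edge and the inclusion is an isomorphism, remove the vertex and the incident edge. (M3) Remove an edge of a vertex space that is not the image of an edge of any incident edge space. (M4) If an edge $e$ of a vertex space $V$ is the image of only one edge $e'\subset E$ among all the incident edge spaces, remove $e$ from $V$ and $e'$ from $E$; if a vertex space is a point with only one incident edge space, remove the vertex and the incident edge. **Simple-edged.** $X$ is simple-edged if no vertex space contains a bigon, i.e. no vertex space has two distinct edges with the same pair of endpoints. **Subgraphs.** The horizontal subgraph $\Gamma_H\subset X$ has as vertices the vertices of the vertex spaces and as edges the arcs $\{p\}\times I$ for $p$ a vertex of an edge space. The mid-graph $\Gamma_M\subset X$ has as vertices the midpoints of edges of the vertex spaces and as edges the arcs $\{p\}\times I$ for $p$ the midpoint of an edge of an edge space. **Representing.**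 Here $H_1,H_2,M_j$ are finitely generated free groups, and $\Delta(H_1,H_2;M_j)$ denotes a graph of free groups with vertex groups $H_1,H_2$ and edge groups $M_j$, without monogons (every edge joins the vertex of $H_1$ to the vertex of $H_2$), together with a homomorphism to the free group $\mathbb{F}$ that embeds each $H_i$. The graph of graphs $X$ represents this homomorphism when all of the following hold. - An $\epsilon$-neighborhood of $\Gamma_M$ in $X$ is a product $I\times\Gamma_M$, giving two natural immersions of components of $\Gamma_M$ into $\Gamma_H$. - $\Gamma_H$ has exactly two connected components $\Gamma_{H_1},\Gamma_{H_2}$, with $\pi_1(\Gamma_{H_i})=H_i$. - The components of $\Gamma_M$ are graphs $\Gamma_{M_j}$ in bijection with the edge groups, with $\pi_1(\Gamma_{M_j})=M_j$, and the immersions $\Gamma_{M_j}\to\Gamma_{H_1}$ and $\Gamma_{M_j}\to\Gamma_{H_2}$ induce the edge-group inclusions, so that $\pi_1(X)$ is the fundamental group of $\Delta(H_1,H_2;M_j)$. - The homomorphism $\pi_1(X)\to\mathbb{F}$ factors through the natural map $\pi_1(X)\to\pi_1(\Gamma_U(X))$, and $\Gamma_H\to\Gamma_U(X)$ is an immersion. **Euler characteristics.** $\chi(H_i)=\chi(\Gamma_{H_i})$ and $\chi(M_j)=\chi(\Gamma_{M_j})$; equivalently $\chi(F)=1-\mathrm{rank}(F)$ for a finitely generated free group $F$. *)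

(* Defs.v *)
From HB Require Import structures.
From mathcomp Require Import all_boot all_order all_algebra all_fingroup.

Set Implicit Arguments.
Unset Strict Implicit.
Unset Printing Implicit Defensive.

Import Order.TTheory GRing.Theory Num.Theory.

(** Loops and multiple edges are allowed.  An edge [e] is a copy of [I] whose
    two ends [false], [true] are attached to [ends e false], [ends e true];
    this orientation is only a parametrization, morphisms need not respect it. *)
Record graph := Graph {
  verts : finType;
  edges : finType;
  ends : edges -> bool -> verts }.

(** A dart (oriented edge, or half-edge) is an edge with its initial end. *)
Definition dart (G : graph) : finType := (edges G * bool)%type.

Definition src (G : graph) (d : dart G) : verts G := ends d.1 d.2.
Definition rdart (G : graph) (d : dart G) : dart G := (d.1, ~~ d.2).
Definition tgt (G : graph) (d : dart G) : verts G := src (rdart d).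

Definition darts_at (G : graph) (v : verts G) : {set dart G} :=
  [set d : dart G | src d == v].

(** A loop counts twice. *)
Definition valence (G : graph) (v : verts G) : nat := #|darts_at v|.

Definition adj (G : graph) : rel (verts G) :=
  fun x y => [exists d : dart G, (src d == x) && (tgt d == y)].

Definition linked (G : graph) : rel (verts G) := connect (@adj G).

(** Exactly one connected component; in particular not empty. *)
Definition connected (G : graph) : bool :=
  (0 < #|verts G|) && [forall x : verts G, [forall y : verts G, linked x y]].

Definition no_bigon (G : graph) : Prop :=
  forall d d' : dart G, src d = src d' -> tgt d = tgt d' -> d.1 = d'.1.

(** [mflip f e] tells whether [f] reverses the parametrization of [e]. *)
Record gmorph (G G' : graph) := GMorph {
  mv : verts G -> verts G';
  me : edges G -> edges G';
  mflip : edges G -> bool;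
  mends : forall e b, ends (me e) (mflip e (+) b) = mv (ends e b) }.

Definition mdart (G G' : graph) (f : gmorph G G') (d : dart G) : dart G' :=
  (me f d.1, mflip f d.1 (+) d.2).

Definition mpath (G G' : graph) (f : gmorph G G') (s : seq (dart G)) :
  seq (dart G') := map (mdart f) s.

Definition embedding (G G' : graph) (f : gmorph G G') : Prop :=
  injective (mv f) /\ injective (me f).

Definition is_iso (G G' : graph) (f : gmorph G G') : Prop :=
  bijective (mv f) /\ bijective (me f).

Definition immersion (G G' : graph) (f : gmorph G G') : Prop :=
  forall d d' : dart G, src d = src d' -> mdart f d = mdart f d' -> d = d'.

Fixpoint is_path (G : graph) (x y : verts G) (s : seq (dart G)) : bool :=
  if s is d :: s' then (src d == x) && is_path (tgt d) y s' else x == y.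

Definition rpath (G : graph) (s : seq (dart G)) : seq (dart G) :=
  rev (map (@rdart G) s).

(** Homotopy rel endpoints of edge paths in the 2-complex obtained from the
    1-complex [G] by attaching a 2-cell along [a] followed by the reverse of
    [b], for all pairs of paths with [cell a b]. *)
Section Homotopy.
Variables (G : graph) (cell : seq (dart G) -> seq (dart G) -> Prop).
Variables (x y : verts G).

Inductive homotopic : seq (dart G) -> seq (dart G) -> Prop :=
| htp_refl s : is_path x y s -> homotopic s s
| htp_sym s t : homotopic s t -> homotopic t s
| htp_trans s t u : homotopic s t -> homotopic t u -> homotopic s u
| htp_spur s1 d s2 :
    is_path x y (s1 ++ s2) -> is_path x y (s1 ++ [:: d; rdart d] ++ s2) ->
    homotopic (s1 ++ s2) (s1 ++ [:: d; rdart d] ++ s2)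
| htp_cell s1 a b s2 : cell a b ->
    is_path x y (s1 ++ a ++ s2) -> is_path x y (s1 ++ b ++ s2) ->
    homotopic (s1 ++ a ++ s2) (s1 ++ b ++ s2).
End Homotopy.

Definition no_cell (G : graph) : seq (dart G) -> seq (dart G) -> Prop :=
  fun _ _ => False.

(** Elements of the fundamental group at [x] are homotopy classes of edge loops
    at [x], multiplied by concatenation.  A map out of this group is given by its
    composition with the projection from loops to classes; the values of [phi]
    on sequences which are not loops at [x] are irrelevant. *)
Section Pi1.
Variables (G : graph) (cell : seq (dart G) -> seq (dart G) -> Prop).
Variables (x : verts G) (K : groupType) (phi : seq (dart G) -> K).

Definition pi1_mult : Prop :=
  forall s t, is_path x x s -> is_path x x t -> phi (s ++ t) = (phi s * phi t)%g.

Definition pi1_hom : Prop :=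
  pi1_mult /\ (forall s t, homotopic cell x x s t -> phi s = phi t).

Definition pi1_iso : Prop :=
  [/\ pi1_mult,
      (forall s t, is_path x x s -> is_path x x t ->
        (phi s = phi t <-> homotopic cell x x s t))
    & (forall h : K, exists2 s, is_path x x s & phi s = h)].
End Pi1.

Definition free_basis (G : groupType) (S : Type) (b : S -> G) : Prop :=
  forall (K : groupType) (y : S -> K),
    exists2 f : {multiplicative G -> K}, (forall s, f (b s) = y s) &
      forall g : {multiplicative G -> K}, (forall s, g (b s) = y s) -> g =1 f.

Definition is_free (G : groupType) : Prop :=
  exists (S : Type) (b : S -> G), free_basis b.

Record fg_free_group := FGFree {
  fg_sort :> groupType;
  fg_rank : nat;
  fg_basis : 'I_fg_rank -> fg_sort;
  fg_basisP : free_basis fg_basis }.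

Definition chi (F : fg_free_group) : int := (1 - (fg_rank F)%:Z)%R.

(** The vertex groups [H_1], [H_2] are [vgrp false], [vgrp true]. *)
Record free_splitting := FreeSplitting {
  vgrp : bool -> fg_free_group;
  eidx : finType;
  egrp : eidx -> fg_free_group;
  einc : forall (j : eidx) (i : bool), {multiplicative egrp j -> vgrp i};
  einc_inj : forall j i, injective (einc j i) }.

Definition H1 (D : free_splitting) : fg_free_group := vgrp D false.
Definition H2 (D : free_splitting) : fg_free_group := vgrp D true.

(** A homomorphism from the fundamental group of the (connected) graph of groups
    [D], relative to the maximal tree consisting of the edge [tree_edge], to [F],
    given on the standard generators: the two vertex groups and one stable letter
    for each edge, that of [tree_edge] being trivial.  It is moreover required
    to embed the vertex groups. *)
Record splitting_hom (D : free_splitting) (F : groupType) := SplittingHom {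
  tree_edge : eidx D;
  on_vgrp : forall i : bool, {multiplicative vgrp D i -> F};
  on_stable : eidx D -> F;
  on_tree : on_stable tree_edge = 1%g;
  on_rel : forall (j : eidx D) (m : egrp j),
    (on_vgrp false (einc j false m) * on_stable j =
     on_stable j * on_vgrp true (einc j true m))%g;
  on_vgrp_inj : forall i, injective (on_vgrp i) }.

Record graph_of_graphs := GraphOfGraphs {
  under : graph;
  vsp : verts under -> graph;
  esp : edges under -> graph;
  att : forall (e : edges under) (b : bool), gmorph (esp e) (vsp (ends e b));
  att_emb : forall e b, embedding (att e b) }.

Section GraphOfGraphs.
Variable X : graph_of_graphs.

(** Vertices and edges of the disjoint union of the vertex spaces,
    and then of the edge spaces. *)
Definition vspV : finType := {v : verts (under X) & verts (vsp v)}.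
Definition vspE : finType := {v : verts (under X) & edges (vsp v)}.
Definition espV : finType := {e : edges (under X) & verts (esp e)}.
Definition espE : finType := {e : edges (under X) & edges (esp e)}.

Definition attV (e : edges (under X)) (b : bool) (q : verts (esp e)) : vspV :=
  Tagged (fun v => verts (vsp v)) (mv (att e b) q).
Definition attE (e : edges (under X)) (b : bool) (q : edges (esp e)) : vspE :=
  Tagged (fun v => edges (vsp v)) (me (att e b) q).

Definition endV (m : vspE) (b : bool) : vspV :=
  Tagged (fun v => verts (vsp v)) (ends (tagged m) b).
Definition endE (x : espE) (b : bool) : espV :=
  Tagged (fun e => verts (esp e)) (ends (tagged x) b).

(** The horizontal subgraph and the mid-graph; an edge is identified with
    its midpoint. *)
Definition GammaH : graph :=
  @Graph vspV espV (fun p b => attV b (tagged p)).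
Definition GammaM : graph :=
  @Graph vspE espE (fun x b => attE b (tagged x)).

Definition GammaH_to_under : gmorph GammaH (under X) :=
  @GMorph GammaH (under X) (@tag _ _) (@tag _ _) (fun=> false)
    (fun _ _ => erefl).

Definition M1_applies : Prop :=
  (exists v : verts (under X), ~~ connected (vsp v)) \/
  (exists e : edges (under X), ~~ connected (esp e)).

(** There are two edges to be merged only if the two half-edges at [v] do not
    form a loop. *)
Definition M2_merge_applies : Prop :=
  exists (v : verts (under X)) (h h' : dart (under X)),
    [/\ h.1 != h'.1, darts_at v = [set h; h'],
        is_iso (att h.1 h.2) & is_iso (att h'.1 h'.2)].

Definition M2_prune_applies : Prop :=
  exists (v : verts (under X)) (h : dart (under X)),
    darts_at v = [set h] /\ is_iso (att h.1 h.2).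

(** A dart [(x, b)] of [GammaM] starting at [m] is an edge [x] of an incident
    edge space which the embedding at the end [b] sends to [m].  The two ends of
    a loop of the underlying graph count separately. *)
Definition M3_applies : Prop := exists m : vspE, #|@darts_at GammaM m| = 0.

Definition M4_collapse_applies : Prop :=
  exists m : vspE, #|@darts_at GammaM m| = 1.

Definition M4_prune_applies : Prop :=
  exists v : verts (under X),
    [/\ #|verts (vsp v)| = 1, #|edges (vsp v)| = 0 & valence v = 1].

Definition reduced : Prop :=
  [/\ ~ M1_applies, ~ (M2_merge_applies \/ M2_prune_applies), ~ M3_applies
    & ~ (M4_collapse_applies \/ M4_prune_applies)].

Definition simple_edged : Prop := forall v, no_bigon (@vsp X v).

(** [Delta] is the disjoint union, over the vertices [v] of the underlying graph,
    of the intersections of the images of the edge spaces incident to [v]. *)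
Definition DeltaV : {set vspV} :=
  [set p : vspV | [forall h : dart (under X), (src h == tag p) ==>
     [exists q : verts (esp h.1), attV h.2 q == p]]].

Definition DeltaE : {set vspE} :=
  [set m : vspE | [forall h : dart (under X), (src h == tag m) ==>
     [exists x : edges (esp h.1), attE h.2 x == m]]].

(** The 1-skeleton consists of the horizontal edges and of the edges of the vertex
    spaces; there is one square for each edge of an edge space. *)
Definition skeleton : graph :=
  @Graph vspV (espV + vspE)%type
    (fun a b => match a with inl p => @ends GammaH p b | inr m => endV m b end).

Definition hdart (d : dart GammaH) : dart skeleton := (inl d.1, d.2).
Definition hpath (s : seq (dart GammaH)) : seq (dart skeleton) := map hdart s.
Definition vdart (m : vspE) (b : bool) : dart skeleton := (inr m, b).

(** The image under the embedding at the end [b] of the dart of the edge space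
    running along [x] from its end [false]. *)
Definition att_dart (x : espE) (b : bool) : dart skeleton :=
  vdart (attE b (tagged x)) (mflip (att (tag x) b) (tagged x)).

Inductive square : seq (dart skeleton) -> seq (dart skeleton) -> Prop :=
| Square (x : espE) :
    square [:: att_dart x false; hdart (endE x true, false)]
           [:: hdart (endE x false, false); att_dart x true].

(** The natural map to the underlying graph, collapsing the vertex spaces. *)
Definition to_under (s : seq (dart skeleton)) : seq (dart (under X)) :=
  pmap (fun d : dart skeleton =>
          if d.1 is inl p then Some (tag p, d.2) else None) s.

(** The neighborhood of [GammaM] is an interval bundle, whose fiber over the
    midpoint [m] of an edge is a subinterval of this edge.  A product structure is
    a coherent labelling of the ends of the fibers: [or_v m] and [or_e x] are the
    ends, of the edge [m] of a vertex space and of the edge [x] of an edge space,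
    lying on side [false]. *)
Record product_nbhd := ProductNbhd {
  or_v : vspE -> bool;
  or_e : espE -> bool;
  or_att : forall (x : espE) (b : bool),
    or_v (attE b (tagged x)) = mflip (att (tag x) b) (tagged x) (+) or_e x }.

Lemma side_subproof (P : product_nbhd) (i : bool) (x : espE) (b : bool) :
  @ends GammaH (endE x (or_e P x (+) i)) (false (+) b) =
  endV (attE b (tagged x)) (or_v P (attE b (tagged x)) (+) i).
Proof.
rewrite or_att -addbA /endV /= /attV; congr (Tagged _ _).
by rewrite -mends.
Qed.

(** The natural map from [GammaM] to [GammaH], moving to the side [i]. *)
Definition side (P : product_nbhd) (i : bool) : gmorph GammaM GammaH :=
  @GMorph GammaM GammaH (fun m => endV m (or_v P m (+) i))
    (fun x => endE x (or_e P x (+) i)) (fun=> false) (side_subproof P i).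

End GraphOfGraphs.

(** The components [Gamma_{H_1}], [Gamma_{H_2}] of [GammaH] are those of the base
    points [hbase false], [hbase true]; [Gamma_{M_j}] is the component of [GammaM]
    of the base point [mbase j].  The product structure is chosen so that the side
    [i] of [GammaM] maps to the component of [hbase i].  Since the inclusions of
    the edge groups depend on the choice of base points, they are compared along
    paths [conn j i] in [Gamma_{H_i}]; then [cross j], a path in [X] from
    [hbase false] to [hbase true] through the midpoint [mbase j], corresponds to
    the edge [j] of the graph of groups.  Under the resulting identification of the
    fundamental group of [X] at [hbase false] with that of the graph of groups,
    [H_2] is carried along [cross (tree_edge rho)], and [xhom] is [rho]. *)
Record represents (X : graph_of_graphs) (D : free_splitting) (F : groupType)
    (rho : splitting_hom D F) := Represents {
  nbhd : product_nbhd X;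
  side_imm : forall i, immersion (side nbhd i);
  hbase : bool -> verts (GammaH X);
  hbase_sep : ~~ linked (hbase false) (hbase true);
  hbase_all : forall p, linked (hbase false) p || linked (hbase true) p;
  hmark : forall i : bool, seq (dart (GammaH X)) -> vgrp D i;
  hmark_iso : forall i, pi1_iso (@no_cell (GammaH X)) (hbase i) (hmark i);
  mbase : eidx D -> verts (GammaM X);
  mbase_inj : forall j k, linked (mbase j) (mbase k) -> j = k;
  mbase_all : forall m, exists j, linked (mbase j) m;
  mmark : forall j : eidx D, seq (dart (GammaM X)) -> egrp j;
  mmark_iso : forall j, pi1_iso (@no_cell (GammaM X)) (mbase j) (mmark j);
  conn : eidx D -> bool -> seq (dart (GammaH X));
  conn_path : forall j i,
    is_path (hbase i) (mv (side nbhd i) (mbase j)) (conn j i);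
  side_inc : forall j i s, is_path (mbase j) (mbase j) s ->
    einc j i (mmark j s) =
    hmark i (conn j i ++ mpath (side nbhd i) s ++ rpath (conn j i));
  cross : eidx D -> seq (dart (skeleton X)) := fun j =>
    hpath (conn j false) ++
    vdart (mbase j) (or_v nbhd (mbase j)) :: hpath (rpath (conn j true));
  xhom : seq (dart (skeleton X)) -> F;
  xhom_hom : pi1_hom (@square X) (hbase false : verts (skeleton X)) xhom;
  xhom_H1 : forall s, is_path (hbase false) (hbase false) s ->
    on_vgrp rho false (hmark false s) = xhom (hpath s);
  xhom_H2 : forall s, is_path (hbase true) (hbase true) s ->
    on_vgrp rho true (hmark true s) =
    xhom (cross (tree_edge rho) ++ hpath s ++ rpath (cross (tree_edge rho)));
  xhom_stable : forall j,
    on_stable rho j = xhom (cross j ++ rpath (cross (tree_edge rho)));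
  uhom : seq (dart (under X)) -> F;
  uhom_hom : pi1_hom (@no_cell (under X)) (tag (hbase false)) uhom;
  xhom_factor : forall s,
    is_path (hbase false : verts (skeleton X)) (hbase false) s ->
    xhom s = uhom (to_under s);
  GammaH_imm : immersion (GammaH_to_under X) }.

Section Sigma.
Variables (X : graph_of_graphs) (D : free_splitting) (F : groupType).
Variables (rho : splitting_hom D F) (R : represents X rho).

Definition Sigma (i : bool) : {set vspV X} :=
  [set p in DeltaV X | linked (hbase R i) p].
Definition Sigma1 : {set vspV X} := Sigma false.
Definition Sigma2 : {set vspV X} := Sigma true.
End Sigma.

(* Main.v *)
Require Import Defs.
From HB Require Import structures.
From mathcomp Require Import all_boot all_order all_algebra all_fingroup.
From mathcomp Require Import ring lra zify.

Set Implicit Arguments.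
Unset Strict Implicit.
Unset Printing Implicit Defensive.

Import GRing.Theory Num.Theory.

(** The formula is a valence count.  In a finite graph all of whose vertices have
    valence two or three, the handshake identity gives
    [2 chi = - (number of vertices of valence three)]; so the theorem follows once
    the trivalent vertices of [GammaH] and of [GammaM] are identified with the
    vertices and edges of [Delta], and once the Euler characteristic of a marking
    group, defined as one minus its rank, is known to be that of the component
    which it marks.

    Valences.  The map from [GammaH] to the underlying graph is an immersion, and
    so is the composite from [GammaM] through a side map.  An immersion is
    injective on the darts at a vertex, so all valences are at most three, with
    equality exactly when every dart downstairs lifts, that is when every
    incident edge space contains the given vertex or edge ([valenceH_eq3],
    [valenceM_eq3]).  Reducedness bounds valences from below.  By (M3) and (M4)
    each vertex of [GammaM] has valence at least two.  A vertex of [GammaH] which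
    is an endpoint of an edge of its vertex space inherits this bound along a side
    map; otherwise its vertex space, connected by (M1), is a single point, which
    is covered by all three incident (nonempty) edge spaces ([valenceH_ge2]).
    Hence [chi(H_i) = - |Sigma_i| / 2] and [sum_j chi(M_j) = - mu / 2]; the formula
    multiplies the two instances of the former and adds the latter.

    Ranks.  Let a component [C] be marked by a free group of rank [n].  By freeness
    a homomorphism from this group to [F_2] is an arbitrary choice of [n] values.
    On the other hand a homomorphism from the fundamental group of [C] to [F_2] is
    the sum along loops of an edge labelling ([pi1_hom_csum]), unique up to
    coboundaries of vertex labellings, and the only labellings with zero
    coboundary are the two constants.  Thus
    [0 -> F_2 -> F_2^V(C) -> F_2^E(C) -> F_2^n -> 0] is exact, which gives
    [n = 1 - |V(C)| + |E(C)|] ([rank_pi1]).  With coefficients in [F_2] edge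
    orientations carry no sign. *)

(** * Paths, components and homotopies *)

Section Paths.
Variable G : graph.
Implicit Types (x y z v : verts G) (s t : seq (dart G)) (d : dart G).

Lemma rdartK : involutive (@rdart G).
Proof. by case=> e b; rewrite /rdart negbK. Qed.

Lemma src_rdart d : src (rdart d) = tgt d. Proof. by []. Qed.

Lemma tgt_rdart d : tgt (rdart d) = src d.
Proof. by rewrite /tgt rdartK. Qed.

Lemma is_path_cat x y z s t :
  is_path x y s -> is_path y z t -> is_path x z (s ++ t).
Proof.
elim: s x => [|d s IHs] x /=; first by move/eqP->.
by case/andP=> -> /IHs h /h.
Qed.

Lemma rpath_cons d s : rpath (d :: s) = rpath s ++ [:: rdart d].
Proof. by rewrite /rpath /= rev_cons cats1. Qed.

Lemma rpath_cat s t : rpath (s ++ t) = rpath t ++ rpath s.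
Proof. by rewrite /rpath map_cat rev_cat. Qed.

Lemma rpathK : involutive (@rpath G).
Proof.
move=> s; rewrite /rpath map_rev revK -map_comp map_id_in // => d _ /=.
by rewrite rdartK.
Qed.

Lemma is_path_rpath x y s : is_path x y s -> is_path y x (rpath s).
Proof.
elim: s x => [|d s IHs] x /=; first by rewrite eq_sym.
case/andP=> /eqP<- /IHs h; rewrite rpath_cons; apply: is_path_cat h _ => /=.
by rewrite src_rdart tgt_rdart !eqxx.
Qed.

Lemma linkedP x y : reflect (exists s, is_path x y s) (linked x y).
Proof.
apply: (iffP connectP) => [[p px ->]|[s]].
  elim: p x px => [|z p IHp] x /=; first by exists [::]; rewrite /= eqxx.
  case/andP=> /existsP[d /andP[dx /eqP dz]] /IHp[s hs].
  by exists (d :: s); rewrite /= dx dz.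
elim: s x => [|d s IHs] x /=; first by move/eqP->; exists [::].
case/andP=> dx /IHs[p px ->]; exists (tgt d :: p) => //=.
by rewrite px andbT; apply/existsP; exists d; rewrite dx eqxx.
Qed.

Lemma linked_sym : symmetric (@linked G).
Proof.
move=> x y; apply/linkedP/linkedP => -[s hs];
  by exists (rpath s); apply: is_path_rpath.
Qed.

Lemma linked_trans : transitive (@linked G).
Proof. exact: connect_trans. Qed.

Lemma linked_ends e b : linked (ends e false) (@ends G e b).
Proof.
case: b; last exact: connect0.
by apply/linkedP; exists [:: (e, false)]; rewrite /= !eqxx.
Qed.

Lemma linked_dart x d : linked x (src d) = linked x (ends d.1 false).
Proof.
have h := linked_ends d.1 d.2.
apply/idP/idP=> hx; apply: linked_trans hx _ => //.
by rewrite linked_sym.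
Qed.

Lemma linked_tgt x d : linked x (tgt d) = linked x (src d).
Proof. by rewrite -src_rdart !linked_dart. Qed.

Lemma homotopic_is_path cell x y s t :
  @homotopic G cell x y s t -> is_path x y s /\ is_path x y t.
Proof. by elim=> // [? ? _ []|? ? ? _ [? _] _ []]. Qed.

(** The paths [T v] play the role of a maximal tree of the component of [x]; they
    need not fit together. *)
Lemma component_paths x :
  exists T : verts G -> seq (dart G), forall v, linked x v -> is_path x v (T v).
Proof.
apply: (fin_all_exists (P := fun v s => linked x v -> is_path x v s)) => v.
by case: (linkedP x v) => [[s hs]|//]; [exists s|exists [::]].
Qed.

Lemma homotopic_cancel cell x y z v s1 s2 t :
    is_path x z s1 -> is_path z v t -> is_path z y s2 ->
  @homotopic G cell x y (s1 ++ s2) (s1 ++ t ++ rpath t ++ s2).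
Proof.
elim: t z s1 s2 => [|d t IHt] z s1 s2 hs1 ht hs2 /=.
  by apply: htp_refl; apply: is_path_cat hs2.
case/andP: ht => /eqP dz ht.
have hd : is_path z z [:: d; rdart d].
  by rewrite /= dz src_rdart tgt_rdart dz !eqxx.
apply: htp_trans (@htp_spur _ _ _ _ s1 d s2 _ _) _.
- exact: is_path_cat hs2.
- by apply: is_path_cat hs1 _; apply: is_path_cat hs2.
have := IHt (tgt d) (s1 ++ [:: d]) (rdart d :: s2).
rewrite rpath_cons -!catA /=; apply=> //.
  by apply: is_path_cat hs1 _; rewrite /= dz !eqxx.
by rewrite /= src_rdart eqxx tgt_rdart dz.
Qed.

End Paths.

(** Evaluating [psi] on any loop over a given element of [K] is well defined, since
    homotopic loops are exactly those with the same image under [phi]. *)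
Lemma pi1_hom_factor (G : graph) (cell : seq (dart G) -> seq (dart G) -> Prop)
    (x : verts G) (K L : groupType)
    (phi : seq (dart G) -> K) (psi : seq (dart G) -> L) :
    pi1_iso cell x phi -> pi1_hom cell x psi ->
  exists f : {multiplicative K -> L},
    forall s, is_path x x s -> f (phi s) = psi s.
Proof.
case=> phiM phi_eq phi_onto [psiM psi_eq].
have ex h : exists s, is_path x x s && (phi s == h).
  by have [s hs <-] := phi_onto h; exists s; rewrite hs eqxx.
pose f h := psi (xchoose (ex h)).
have fP s : is_path x x s -> f (phi s) = psi s.
  move=> hs; have /andP[ht /eqP eq_st] := xchooseP (ex (phi s)).
  exact/psi_eq/(phi_eq _ _ ht hs).1.
have fM : {morph f : g h / (g * h)%g}.
  move=> g h; have [s hs <-] := phi_onto g; have [t ht <-] := phi_onto h.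
  by rewrite -phiM // !fP ?psiM //; apply: is_path_cat ht.
pose fm := isMultiplicative.Build K L f fM.
pose F : {multiplicative K -> L} := HB.pack f fm.
by exists F.
Qed.

(** * Homomorphisms from the fundamental group to F_2 *)

Section Cochains.
Variable G : graph.
Local Open Scope ring_scope.

(** Labelling edges rather than darts makes [c] a cochain, as a class in [F_2] is
    its own opposite. *)
Definition csum (c : edges G -> 'F_2) (s : seq (dart G)) : 'F_2 :=
  \sum_(d <- s) c d.1.

Lemma F2_addxx (a : 'F_2) : a + a = 0.
Proof. by case: a => [[|[|//]] h]; apply/val_inj. Qed.

Lemma csum_cons c d s : csum c (d :: s) = c d.1 + csum c s.
Proof. exact: big_cons. Qed.

Lemma csum_cat c s t : csum c (s ++ t) = csum c s + csum c t.
Proof. exact: big_cat. Qed.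

Lemma csum_rpath c s : csum c (rpath s) = csum c s.
Proof. by rewrite /csum /rpath (perm_big _ (permEl (perm_rev _))) big_map. Qed.

Lemma csum_pi1_hom c x : pi1_hom (@no_cell G) x (csum c).
Proof.
split=> [s t _ _|s t]; first exact: csum_cat.
elim=> // [s' t' u _ -> _ -> //|s1 d s2 _ _].
have spur0 : csum c [:: d; rdart d] = 0.
  by rewrite /csum !big_cons big_nil /= addr0 F2_addxx.
by rewrite !csum_cat spur0 add0r.
Qed.

(** The label of an edge is the value of [psi] on the loop which reaches this edge
    from [x] by a chosen path, crosses it and comes back by a chosen path; along a
    loop all chosen paths cancel except the two at [x], which contribute equally. *)
Lemma pi1_hom_csum x (psi : seq (dart G) -> 'F_2) :
    pi1_hom (@no_cell G) x psi ->
  exists c, forall s, is_path x x s -> psi s = csum c s.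
Proof.
case=> psiM psi_eq.
have [T hT] := component_paths x.
have psi0 : psi [::] = 0.
  by apply: (addIr (psi [::])); rewrite add0r -[LHS]psiM /= ?eqxx.
have psiV s : is_path x x s -> psi (rpath s) = psi s.
  move=> hs; apply/eqP; rewrite -subr_eq0.
  rewrite (_ : - psi s = psi s); last first.
    by apply/eqP; rewrite -subr_eq0 -opprD F2_addxx oppr0.
  rewrite -[_ + _]psiM ?is_path_rpath // -psi0; apply/eqP/esym/psi_eq.
  have := @homotopic_cancel G (@no_cell G) x x x x [::] [::] (rpath s).
  by rewrite /= rpathK cats0; apply; rewrite ?is_path_rpath.
(* The loop at [x] attached to a dart; reversing the dart reverses the loop. *)
pose k d := T (src d) ++ d :: rpath (T (tgt d)).
have k_path d : linked x (src d) -> is_path x x (k d).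
  move=> hd; apply: is_path_cat (hT _ hd) _; rewrite /= eqxx /=.
  by apply/is_path_rpath/hT; rewrite linked_tgt.
pose c e := psi (k (e, false)).
have cE d : linked x (src d) -> c d.1 = psi (k d).
  case: d => e [] // hd.
  by rewrite -psiV ?k_path // /c /k rpath_cat rpath_cons rpathK -catA.
(* The telescoping: all intermediate return trips are homotoped away. *)
have main s v w : linked x v -> is_path v w s ->
    csum c s = psi (T v ++ s ++ rpath (T w)).
  elim: s v => [|d s IHs] v hv /=.
    move/eqP=> <-; rewrite /csum big_nil -psi0.
    apply: psi_eq.
    have := @homotopic_cancel G (@no_cell G) x x x v [::] [::] (T v).
    by rewrite /= cats0; apply=> //; exact: hT.
  case/andP=> /eqP dv hs.
  have hd : linked x (src d) by rewrite dv.
  have ht : linked x (tgt d) by rewrite linked_tgt.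
  have hw : linked x w by apply: connect_trans ht _; apply/linkedP; exists s.
  rewrite /csum big_cons -/(csum c s) (IHs (tgt d)) // cE //.
  have hsw : is_path (tgt d) x (s ++ rpath (T w)).
    by apply: is_path_cat hs _; apply/is_path_rpath/hT.
  rewrite -[LHS]psiM ?k_path //; last by apply: is_path_cat hsw; apply: hT.
  have hdp : is_path x (tgt d) (T v ++ [:: d]).
    by apply: is_path_cat (hT _ hv) _; rewrite /= dv !eqxx.
  have := @homotopic_cancel G (@no_cell G) x x (tgt d) x (T v ++ [:: d])
    (s ++ rpath (T w)) (rpath (T (tgt d))) hdp (is_path_rpath (hT _ ht)) hsw.
  by move/psi_eq; rewrite rpathK /k dv -!catA /= => ->.
(* For a loop at [x] the conjugating path [T x] does not matter in [F_2]. *)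
exists c => s hs; rewrite (main _ _ _ (connect0 _ x) hs).
have hTx := hT _ (connect0 _ x); have hrx := is_path_rpath hTx.
rewrite psiM //; last exact: is_path_cat hrx.
by rewrite psiM // psiV // [RHS]addrCA F2_addxx addr0.
Qed.
End Cochains.

(** * The rank of the fundamental group of a component *)

Section Extension.
Local Open Scope ring_scope.
Variables (T : finType) (P : pred T).

(** Cochains of a component are functions on subtypes, so that their dimension is
    immediate; they are summed along paths of the whole graph through their
    extension by zero. *)
Definition ext0 (c : {ffun {t | P t} -> ('F_2)^o}) (t : T) : 'F_2 :=
  oapp c 0 (insub t).

Lemma ext0_linear a c c' t : ext0 (a *: c + c') t = a * ext0 c t + ext0 c' t.
Proof.
by rewrite /ext0; case: insub => [u|] /=; rewrite ?ffunE ?mulr0 ?addr0.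
Qed.

Lemma ext0_val c u : ext0 c (val u) = c u.
Proof. by rewrite /ext0 valK. Qed.

Lemma ext0_restr (g : T -> 'F_2) t : P t -> ext0 [ffun u => g (val u)] t = g t.
Proof. by move=> Pt; rewrite /ext0 insubT /= ffunE. Qed.
End Extension.

Lemma dim_F2_ffun (I : finType) : dim {ffun I -> ('F_2)^o} = #|I|.
Proof. exact: muln1. Qed.

Section CohomologyMaps.
Local Open Scope ring_scope.
Variables (G : graph) (x : verts G) (n : nat) (s : 'I_n -> seq (dart G)).

Definition cochain0 := {ffun {v : verts G | linked x v} -> ('F_2)^o}.
(** An edge lies in the component of [x] as soon as its end [false] does. *)
Definition cochain1 :=
  {ffun {e : edges G | linked x (ends e false)} -> ('F_2)^o}.

Definition coboundary (u : cochain0) : cochain1 :=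
  [ffun e => ext0 u (ends (val e) false) + ext0 u (ends (val e) true)].

Definition evaluation (c : cochain1) : {ffun 'I_n -> ('F_2)^o} :=
  [ffun i => csum (ext0 c) (s i)].

Fact coboundary_is_linear : linear coboundary.
Proof.
move=> a u v; apply/ffunP=> e; rewrite !ffunE !ext0_linear /GRing.scale /=; ring.
Qed.
HB.instance Definition _ :=
  GRing.isLinear.Build 'F_2 cochain0 cochain1 _ coboundary coboundary_is_linear.

Fact evaluation_is_linear : linear evaluation.
Proof.
move=> a u v; apply/ffunP=> i.
rewrite !ffunE /csum /GRing.scale /= mulr_sumr -big_split.
by apply: eq_bigr => d _; rewrite ext0_linear.
Qed.
HB.instance Definition _ :=
  GRing.isLinear.Build 'F_2 cochain1 {ffun 'I_n -> ('F_2)^o} _ evaluation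
    evaluation_is_linear.
End CohomologyMaps.
Arguments coboundary {G} x u.
Arguments evaluation {G} x {n} s c.

Lemma eq_csum_linked (G : graph) (c c' : edges G -> 'F_2) x y s :
    (forall e, linked x (ends e false) -> c e = c' e) ->
  is_path x y s -> csum c s = csum c' s.
Proof.
move=> eqc hs; have := connect0 _ x : linked x x.
move: {1 3}x hs => v; rewrite /csum.
elim: s v => [|d s IHs] v /= hs hv; first by rewrite !big_nil.
case/andP: hs => /eqP dv hs; rewrite !big_cons (IHs _ hs).
  by rewrite eqc // -linked_dart dv.
by rewrite linked_tgt dv.
Qed.

Lemma F2_eq_add (a b : 'F_2) : (a + b = 0 -> a = b)%R.
Proof. by move=> ab0; rewrite -[RHS]add0r -ab0 -addrA F2_addxx addr0. Qed.

Lemma csum_coboundary (G : graph) (u : verts G -> 'F_2) x y s :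
    is_path x y s ->
  csum (fun e => u (ends e false) + u (ends e true))%R s = (u x + u y)%R.
Proof.
elim: s x => [|d s IHs] x /=; first by move/eqP->; rewrite /csum big_nil F2_addxx.
case/andP=> /eqP <- /IHs; rewrite /csum big_cons => ->.
have -> : (u (ends d.1 false) + u (ends d.1 true) = u (src d) + u (tgt d))%R.
  by case: d => e [] //=; rewrite addrC.
by rewrite addrA -(addrA (u (src d))) F2_addxx addr0.
Qed.

(** Exactness of
    [0 -> F_2 -> cochain0 -> cochain1 -> F_2^n -> 0], the last map being the
    evaluation on loops that represent a basis of [F]. *)
Lemma rank_pi1 (G : graph) (x : verts G) (F : fg_free_group)
    (phi : seq (dart G) -> F) :
    pi1_iso (@no_cell G) x phi ->
  (#|[pred e | linked x (@ends G e false)]| + 1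
     = fg_rank F + #|[pred v | linked x v]|)%N.
Proof.
move=> phi_iso; have [_ _ phi_onto] := phi_iso.
have [s hs] : exists s : 'I_(fg_rank F) -> seq (dart G),
    forall i, is_path x x (s i) /\ phi (s i) = fg_basis i.
  apply: (fin_all_exists
    (P := fun i t => is_path x x t /\ phi t = fg_basis i)) => i.
  by have [t ht tE] := phi_onto (fg_basis i); exists t.
pose dl := linfun (coboundary x); pose ev := linfun (evaluation x s).
have dlE u : dl u = coboundary x u by rewrite lfunE.
have evE c : ev c = evaluation x s c by rewrite lfunE.
(* Values prescribed on the basis extend to a homomorphism from [F] to [F_2],
   hence come from a cochain. *)
have ev_onto : limg ev = fullv.
  apply/eqP; rewrite eqEsubv subvf; apply/subvP=> y _; apply/memv_imgP.
  have [f fE _] := fg_basisP (y : 'I_(fg_rank F) -> 'F_2).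
  have psi_hom : pi1_hom (@no_cell G) x (f \o phi).
    have [phiM phi_eq _] := phi_iso; split=> [t t' ht ht'|t t' tt'] /=.
      by rewrite phiM // gmulfM.
    have [ht ht'] := homotopic_is_path tt'.
    by have [_ /(_ _ _ ht ht')[_ ->]] := phi_iso.
  have [c cE] := pi1_hom_csum psi_hom.
  exists [ffun e => c (val e)]; first exact: memvf.
  rewrite evE; apply/ffunP=> i; rewrite ffunE; have [hsi siE] := hs i.
  rewrite -(eq_csum_linked _ hsi (c := c)) => [|e he]; last by rewrite ext0_restr.
  by rewrite -cE //= siE fE.
(* A cochain that vanishes on the basis loops vanishes on all loops, by uniqueness
   of the homomorphism that extends given values on a basis; it is then the
   coboundary of its sums along chosen paths from [x]. *)
have ker_ev : lker ev = limg dl.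
  apply/eqP; rewrite eqEsubv; apply/andP; split; apply/subvP=> c; last first.
    case/memv_imgP=> u _ ->; rewrite memv_ker evE dlE; apply/eqP/ffunP=> i.
    have [hsi _] := hs i; rewrite !ffunE.
    pose u' := ext0 u.
    pose du e := (u' (ends e false) + u' (ends e true))%R.
    rewrite -(eq_csum_linked _ hsi (c := du)).
      by rewrite (csum_coboundary u' hsi) F2_addxx.
    by move=> e he; rewrite /coboundary (ext0_restr du).
  rewrite memv_ker evE => /eqP/ffunP ev0; apply/memv_imgP.
  have [f fE] := pi1_hom_factor phi_iso (csum_pi1_hom (ext0 c) x).
  have c_loop t : is_path x x t -> csum (ext0 c) t = 0%R.
    move=> ht; rewrite -fE //.
    have [f0 _ f0_uniq] := fg_basisP (fun _ : 'I_(fg_rank F) => 0%R : 'F_2).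
    pose fm := isMultiplicative.Build F 'F_2 (fun=> 1%g)
      (fun _ _ => esym (mulg1 _)).
    pose f1 : {multiplicative F -> 'F_2} := HB.pack (fun _ : F => 1%g : 'F_2) fm.
    rewrite (f0_uniq f) => [|i]; first by rewrite -(f0_uniq f1).
    by have [hsi <-] := hs i; rewrite fE //; have := ev0 i; rewrite !ffunE.
  have [T hT] := component_paths x.
  exists [ffun v => csum (ext0 c) (T (val v))]; first exact: memvf.
  rewrite dlE; apply/ffunP=> e; rewrite ffunE.
  have he := valP e.
  have he' : linked x (ends (val e) true).
    exact: connect_trans he (linked_ends _ true).
  rewrite !(ext0_restr (fun v => csum (ext0 c) (T v))) //.
  apply: F2_eq_add; rewrite -(ext0_val c e).
  pose loop := T (ends (val e) false) ++
    (val e, false) :: rpath (T (ends (val e) true)).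
  rewrite -[RHS](c_loop loop).
    by rewrite csum_cat csum_cons csum_rpath addrCA.
  apply: is_path_cat (hT _ he) _; rewrite /= eqxx.
  exact/is_path_rpath/hT.
(* A function with zero coboundary is constant on the component. *)
have ker_dl : lker dl = <[ [ffun=> 1%R] : cochain0 x ]>%VS.
  apply/eqP; rewrite eqEsubv; apply/andP; split; apply/subvP=> u; last first.
    case/vlineP=> a ->; rewrite memv_ker linearZ /= dlE; apply/eqP/ffunP=> e.
    rewrite !ffunE !(ext0_restr (fun=> 1%R)) ?F2_addxx.
    - exact: mulr0.
    - exact: connect_trans (valP e) (linked_ends _ true).
    - exact: valP e.
  rewrite memv_ker dlE => /eqP/ffunP u0; apply/vlineP; exists (ext0 u x).
  apply/ffunP=> v; rewrite !ffunE [RHS]mulr1 -(ext0_val u v).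
  have [t ht] := linkedP _ _ (valP v).
  apply/esym/F2_eq_add; rewrite -(csum_coboundary (ext0 u) ht).
  rewrite (eq_csum_linked (c' := fun=> 0%R) _ ht) => [|e he].
    by rewrite /csum big1.
  by have := u0 (Sub e he); rewrite !ffunE.
have := limg_ker_dim dl fullv; have := limg_ker_dim ev fullv.
rewrite !capfv !dimvf ker_ev ker_dl ev_onto dimvf !dim_F2_ffun dim_vline card_ord.
rewrite !card_sig.
suff -> : ([ffun=> 1%R] : cochain0 x) != 0%R by lia.
by apply/eqP=> /ffunP/(_ (Sub x (connect0 _ x))); rewrite !ffunE.
Qed.

(** * Euler characteristics from valences *)

Lemma handshake (G : graph) (x : verts G) :
  \sum_(v | linked x v) valence v = 2 * #|[pred e | linked x (@ends G e false)]|.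
Proof.
have -> : \sum_(v | linked x v) valence v =
    #|[pred d : dart G | linked x (src d)]|.
  rewrite -sum1_card (partition_big (@src G) (linked x)) //=.
  apply: eq_bigr => v hv; rewrite /valence -sum1_card; apply: eq_bigl => d.
  by rewrite !inE; case: eqP => [->|]; rewrite ?hv ?andbF.
rewrite mulnC -card_bool -cardX; apply: eq_card => -[e b].
by rewrite !inE andbT linked_dart.
Qed.

Lemma chi_of_valences (G : graph) (x : verts G) (F : fg_free_group)
    (phi : seq (dart G) -> F) :
    pi1_iso (@no_cell G) x phi ->
    (forall v, linked x v -> 2 <= valence v <= 3) ->
  (chi F *+ 2 = - #|[set v | linked x v & valence v == 3]|%:Z)%R.
Proof.
move=> phi_iso val23; have := rank_pi1 phi_iso; have := handshake x.
have -> : \sum_(v | linked x v) valence v =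
    #|[pred v | linked x v]| * 2 + #|[pred v | linked x v & valence v == 3]|.
  rewrite (eq_bigr (fun v => 2 + (valence v == 3))) => [|v /val23]; last first.
    by case: (valence v) => [|[|[|[|]]]].
  rewrite big_split /= sum_nat_const; congr (_ + _); rewrite -[RHS]sum1_card.
  by rewrite big_mkcondr /=; apply: eq_bigr => v _; case: ifP => /=.
have -> : #|[set v | linked x v & valence v == 3]| =
  #|[pred v | linked x v & valence v == 3]| by apply: eq_card => v; rewrite !inE.
rewrite /chi; lia.
Qed.

(** * Immersions and valences *)

Section Immersions.
Variables (G G' : graph) (f : gmorph G G').
Hypothesis f_imm : immersion f.

Lemma src_mdart d : src (mdart f d) = mv f (src d).
Proof. exact: mends. Qed.

Lemma mdart_darts_at v : mdart f @: darts_at v \subset darts_at (mv f v).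
Proof.
by apply/subsetP=> _ /imsetP[d + ->]; rewrite !inE src_mdart => /eqP->.
Qed.

Lemma card_mdart_darts_at v : #|mdart f @: darts_at v| = valence v.
Proof.
apply: card_in_imset => d d'; rewrite !inE => /eqP dv /eqP d'v.
by apply: f_imm; rewrite dv.
Qed.

Lemma immersion_valence_le v : valence v <= valence (mv f v).
Proof. by rewrite -card_mdart_darts_at subset_leq_card ?mdart_darts_at. Qed.

(** At each vertex an immersion maps darts injectively, so equality of valences
    means that all darts lift. *)
Lemma immersion_valence_eq v :
  valence v = valence (mv f v) <->
  forall h, src h = mv f v -> exists2 d, src d = v & mdart f d = h.
Proof.
rewrite -card_mdart_darts_at; split=> [eq_card h hv|lift].
  have : h \in mdart f @: darts_at v.
    suff /eqP-> : mdart f @: darts_at v == darts_at (mv f v) by rewrite inE hv.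
    by rewrite eqEcard mdart_darts_at /= eq_card.
  by case/imsetP=> d; rewrite inE => /eqP dv ->; exists d.
congr #|pred_of_set _|; apply/eqP; rewrite eqEsubset mdart_darts_at.
apply/subsetP=> h; rewrite inE => /eqP /lift[d dv <-].
by apply/imset_f; rewrite inE dv.
Qed.
End Immersions.

(** * Valences in the horizontal subgraph and in the mid-graph *)

Section Trivalent.
Variable X : graph_of_graphs.
Hypothesis X_trivalent : forall v : verts (under X), valence v = 3.
Hypothesis H_imm : immersion (GammaH_to_under X).

(** Valence bounds pull back along the immersion into the trivalent [under X]. *)
Lemma valenceH_le3 (p : vspV X) : @valence (GammaH X) p <= 3.
Proof.
exact: leq_trans (immersion_valence_le H_imm p) (eq_leq (X_trivalent _)).
Qed.

(** A dart at [tag p] lifts to [p] exactly when its edge space contains [p] in its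
    image, and [Delta] asks this of all darts at [tag p]. *)
Lemma valenceH_eq3 (p : vspV X) :
  (@valence (GammaH X) p == 3) = (p \in DeltaV X).
Proof.
apply/eqP/idP=> [val3|].
  rewrite inE; apply/forallP=> h; apply/implyP=> /eqP hp.
  have [lift _] := immersion_valence_eq H_imm p.
  have [|[[e q] b] /= dp <- /=] := lift _ h hp; first by rewrite val3 X_trivalent.
  by apply/existsP; exists q; apply/eqP.
rewrite inE => /forallP pD; rewrite -(X_trivalent (tag p)).
apply/(immersion_valence_eq H_imm) => -[e b] hp.
have /existsP[q /eqP qp] := implyP (pD (e, b)) (introT eqP hp).
by exists (Tagged (fun e => verts (esp e)) q, b).
Qed.

Variable P : product_nbhd X.
Hypothesis side_imm : forall i, immersion (side P i).

Definition GammaM_to_under : gmorph (GammaM X) (under X) :=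
  @GMorph (GammaM X) (under X) (@tag _ _) (@tag _ _) (fun=> false)
    (fun _ _ => erefl).

(** This is the composite of a side map with [GammaH_to_under X], both immersions. *)
Lemma GammaM_imm : immersion GammaM_to_under.
Proof.
move=> d d' dd' eq_d; apply: (side_imm (i := false) dd'); apply: H_imm.
  by rewrite !src_mdart dd'.
exact: eq_d.
Qed.

Lemma valenceM_eq3 (m : vspE X) :
  (@valence (GammaM X) m == 3) = (m \in DeltaE X).
Proof.
apply/eqP/idP=> [val3|].
  rewrite inE; apply/forallP=> h; apply/implyP=> /eqP hm.
  have [lift _] := immersion_valence_eq GammaM_imm m.
  have [|[[e x] b] /= dm <- /=] := lift _ h hm; first by rewrite val3 X_trivalent.
  by apply/existsP; exists x; apply/eqP.
rewrite inE => /forallP mD; rewrite -(X_trivalent (tag m)).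
apply/(immersion_valence_eq GammaM_imm) => -[e b] hm.
have /existsP[x /eqP xm] := implyP (mD (e, b)) (introT eqP hm).
by exists (Tagged (fun e => edges (esp e)) x, b).
Qed.

Hypothesis X_reduced : reduced X.

(** Valences zero and one are the situations of (M3) and (M4). *)
Lemma valenceM_ge2 (m : vspE X) : 2 <= @valence (GammaM X) m.
Proof.
have [_ _ noM3 noM4] := X_reduced.
case val_m: (@valence (GammaM X) m) => [|[|//]]; first by case: noM3; exists m.
by case: noM4; left; exists m.
Qed.

(** Either [p] is an endpoint of an edge of its vertex space, and some side map
    carries the midpoint of this edge to [p]; or this connected vertex space is
    reduced to [p], and then all incident edge spaces reach [p]. *)
Lemma valenceH_ge2 (p : vspV X) : 2 <= @valence (GammaH X) p.
Proof.
have [noM1 _ _ _] := X_reduced.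
have conV v : connected (@vsp X v).
  by apply/negP=> /negP nc; apply: noM1; left; exists v.
have conE e : connected (@esp X e).
  by apply/negP=> /negP nc; apply: noM1; right; exists e.
case: p => v p.
have [[e b] dp|isolated] := pickP (fun d : dart (vsp v) => src d == p).
  (* Side [i] sends [m] to its end [or_v P m (+) i]; the end wanted is [b]. *)
  pose m : vspE X := Tagged (fun v => edges (vsp v)) e.
  have := immersion_valence_le (side_imm (i := or_v P m (+) b)) m.
  rewrite /= addKb /endV /=; move: dp; rewrite /src /= => /eqP->.
  exact: leq_trans (valenceM_ge2 m).
suff -> : @valence (GammaH X) (Tagged (fun v => verts (vsp v)) p) = 3 by [].
apply/eqP; rewrite valenceH_eq3 inE.
apply/forallP=> -[e b]; apply/implyP=> /eqP /= hv.
have /andP[/card_gt0P[q _] _] := conE e.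
apply/existsP; exists q; rewrite /attV /=; move: (mv (att e b) q).
rewrite -/(src (e, b)) hv => q'; apply/eqP; congr (Tagged _ _).
have /andP[_ /forallP/(_ p)/forallP/(_ q')/linkedP[[|d s] /=]] := conV v.
  by move/eqP.
by case/andP=> dp; have := isolated d; rewrite dp.
Qed.
End Trivalent.

(** * Euler characteristics of the vertex and edge groups *)

Section Representing.
Variables (X : graph_of_graphs) (D : free_splitting) (F : groupType).
Variables (rho : splitting_hom D F) (R : represents X rho).
Hypothesis X_reduced : reduced X.
Hypothesis X_trivalent : forall v : verts (under X), valence v = 3.
Local Open Scope ring_scope.

Lemma chi_vgrp i : chi (vgrp D i) *+ 2 = - #|Sigma R i|%:Z.
Proof.
rewrite (chi_of_valences (hmark_iso R i)) => [|p _]; last first.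
  by rewrite (valenceH_ge2 X_trivalent (GammaH_imm R) (@side_imm _ _ _ _ R)) //
             (valenceH_le3 X_trivalent (GammaH_imm R)).
congr (- _%:Z); apply: eq_card => p.
by rewrite inE [in RHS]inE (valenceH_eq3 X_trivalent (GammaH_imm R)) andbC.
Qed.

(** The components of the base points [mbase j] partition [GammaM], so the counts of
    trivalent vertices add up to [|DeltaE X|]. *)
Lemma sum_chi_egrp : (\sum_(j : eidx D) chi (egrp j)) *+ 2 = - #|DeltaE X|%:Z.
Proof.
rewrite -sumrMnl.
under eq_bigr => j _.
  rewrite (chi_of_valences (mmark_iso R j)) => [|m _]; last first.
    have imm := GammaM_imm (GammaH_imm R) (@side_imm _ _ _ _ R).
    by rewrite valenceM_ge2 // -(X_trivalent (tag m)) (immersion_valence_le imm).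
  over.
rewrite sumrN; under eq_bigr do rewrite -natz.
rewrite -natr_sum natz; congr (- _%:Z).
have [J hJ] : exists J, forall m, linked (mbase R (J m)) m.
  exact: fin_all_exists (mbase_all R).
rewrite -sum1_card (partition_big J predT) //=; apply: eq_bigr => j _.
rewrite -sum1_card; apply: eq_bigl => m.
rewrite inE andbC.
rewrite (valenceM_eq3 X_trivalent (GammaH_imm R) (@side_imm _ _ _ _ R)).
congr (_ && _); apply/idP/eqP=> [jm|<-//]; apply: mbase_inj.
by apply: linked_trans (hJ m) _; rewrite linked_sym.
Qed.
End Representing.

Local Open Scope ring_scope.

Theorem theorem3p1 (X : graph_of_graphs) (D : free_splitting) (F : groupType)
    (F_free : is_free F) (rho : splitting_hom D F) (R : represents X rho)
    (X_simple : simple_edged X) (X_reduced : reduced X)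
    (X_trivalent : forall v : verts (under X), valence v = 3%N) :
  (chi (H1 D))%:~R * (chi (H2 D))%:~R + \sum_(j : eidx D) (chi (egrp j))%:~R =
  1 / 4%:R * (#|Sigma1 R|%:R * #|Sigma2 R|%:R) - 1 / 2%:R * #|DeltaE X|%:R :> rat.
Proof.
have toQ (z : int) (n : nat) :
    z *+ 2 = - n%:Z -> z%:~R = - (1 / 2%:R) * n%:R :> rat.
  by move/(congr1 (fun z : int => z%:~R : rat)); rewrite rmorphMn rmorphN /=; lra.
rewrite -rmorph_sum /= (toQ _ _ (chi_vgrp R X_reduced X_trivalent false)).
rewrite (toQ _ _ (chi_vgrp R X_reduced X_trivalent true)).
rewrite (toQ _ _ (sum_chi_egrp R X_reduced X_trivalent)).
by rewrite /Sigma1 /Sigma2; field.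
Qed.
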